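(* Let $n\ge 2$, let $J_{kl}\in\mathbb R$ for $1\le k<l\le n$, let $\kappa\in[-1,+1]$, and let $$H_{XY}:=\pi\sum_{k<l}^n J_{kl}\,\tfrac12\big(\sigma_{kx}\otimes\sigma_{lx}+\kappa\,\sigma_{ky}\otimes\sigma_{ly}\big).$$ Suppose the coupling graph (vertices $1,\dots,n$; an edge between $k<l$ iff $J_{kl}\neq0$) is connected. Then the evolution under $H_{XY}$ is type-I invertible by local unitary operations if and only if (i) the coupling graph is bipartite, or (ii) $\kappa=-1$ (in which case the coupling graph may be any connected graph).
   Context: $\sigma_{k\nu}\otimes\sigma_{l\nu}$ ($\nu\in\{x,y\}$) denotes the operator on $(\mathbb C^2)^{\otimes n}$ acting as the Pauli matrix $\sigma_\nu$ on qubits $k$ and $l$ and as the identity on all other qubits. The evolution under a Hamiltonian $H$ is type-I invertible by local unitary operations if there is $K\in\mathbf{SU}(2)^{\otimes n}:=\{K_1\otimes\cdots\otimes K_n:K_\ell\in\mathbf{SU}(2)\}$ with $KHK^{-1}=-H$, equivalently $Ke^{-itH}K^{-1}=e^{itH}$ for all $t\in\mathbb R$. *)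

(* Defs.v *)
From HB Require Import structures.
From mathcomp Require Export all_boot all_order all_algebra.
From mathcomp Require Export spectral.
From mathcomp Require Export complex mxtens.
From mathcomp Require Export reals trigo.

Set Implicit Arguments.
Unset Strict Implicit.
Unset Printing Implicit Defensive.

Import Order.TTheory GRing.Theory Num.Theory.
Local Open Scope ring_scope.
Local Open Scope complex_scope.

(* A_0 *t A_1 *t ... *t A_k, acting on the k.+1 qubits 0, ..., k. The index is
   shifted because [2 ^ k.+2] reduces to [2 * 2 ^ k.+1] but [2 ^ k.+1] does not
   reduce to [2 * 2 ^ k]. *)
Fixpoint tensor_rec (C : comNzRingType) (k : nat) :
    ('I_k.+1 -> 'M[C]_2) -> 'M[C]_(2 ^ k.+1) :=
  match k return ('I_k.+1 -> 'M[C]_2) -> 'M[C]_(2 ^ k.+1) with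
  | 0 => fun A => A ord0
  | k'.+1 => fun A => A ord0 *t tensor_rec (fun i => A (lift ord0 i))
  end.

Definition tensor (C : comNzRingType) (n : nat) :
    ('I_n -> 'M[C]_2) -> 'M[C]_(2 ^ n) :=
  match n return ('I_n -> 'M[C]_2) -> 'M[C]_(2 ^ n) with
  | 0 => fun _ => 1%:M
  | k.+1 => fun A => tensor_rec A
  end.

Definition sigma_x (R : realType) : 'M[R[i]]_2 :=
  \matrix_(a < 2, b < 2) (if a == b then 0 else 1).

(* The matrix with rows (0, -i) and (i, 0). *)
Definition sigma_y (R : realType) : 'M[R[i]]_2 :=
  \matrix_(a < 2, b < 2)
    (if a == b then 0 else if a == ord0 then - 'i%C else 'i%C).

Definition two_qubit (R : realType) (n : nat) (s : 'M[R[i]]_2) (k l : 'I_n) :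
    'M[R[i]]_(2 ^ n) :=
  tensor (fun j => if (j == k) || (j == l) then s else 1%:M).

(* Only the values [J k l] with [k < l] are used, here and in [coupling]. *)
Definition HXY (R : realType) (n : nat) (J : 'I_n -> 'I_n -> R) (kappa : R) :
    'M[R[i]]_(2 ^ n) :=
  (pi : R)%:C *: \sum_(k < n) \sum_(l < n | (k < l)%N)
    ((J k l)%:C / 2) *:
      (two_qubit (sigma_x R) k l + kappa%:C *: two_qubit (sigma_y R) k l).

Definition coupling (R : realType) (n : nat) (J : 'I_n -> 'I_n -> R) :
    rel 'I_n :=
  fun k l => ((k < l)%N && (J k l != 0)) || ((l < k)%N && (J l k != 0)).

Definition connected_graph (T : finType) (e : rel T) : Prop :=
  forall x y : T, connect e x y.

Definition bipartite (T : finType) (e : rel T) : Prop :=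
  exists A : {set T}, forall x y : T, e x y -> (x \in A) != (y \in A).

Definition in_SU2 (R : realType) (U : 'M[R[i]]_2) : Prop :=
  U \is unitarymx /\ \det U = 1.

Definition local_unitary (R : realType) (n : nat) (K : 'M[R[i]]_(2 ^ n)) :
    Prop :=
  exists U : 'I_n -> 'M[R[i]]_2, (forall l, in_SU2 (U l)) /\ K = tensor U.

(* [H] is the Hamiltonian generating the evolution [exp (- i t H)]. *)
Definition typeI_invertible (R : realType) (n : nat) (H : 'M[R[i]]_(2 ^ n)) :
    Prop :=
  exists K : 'M[R[i]]_(2 ^ n), local_unitary K /\ K *m H *m invmx K = - H.

(* Main.v *)
(* If K = K_1 (x) ... (x) K_n inverts H, taking the trace of K H K^-1 = - H
   against A on qubit k and K_l B K_l^-1 on qubit l, with A and B traceless,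
   isolates the coupling of k and l: with r_k(a, b) = tr (K_k s_a K_k^-1 s_b),
   every edge kl gives r_k(x,x) = - r_l(x,x), kappa r_k(y,x) = - r_l(y,x) and
   r_l(z,x) = 0. The three numbers r_k(_,x) do not all vanish, so for
   kappa <> -1 either r(x,x) or r(y,x) is a nowhere zero function changing sign
   along every edge, and the graph is bipartite.
   Conversely, conjugate by sigma_z on one side of the bipartition; if
   kappa = -1, rotate every qubit by a quarter turn about the z axis, which
   exchanges the XX and YY terms. *)
From HB Require Import structures.
Require Import Defs.
From mathcomp Require Import ring.
Import Order.TTheory GRing.Theory Num.Theory.
Local Open Scope ring_scope.

Set Implicit Arguments.
Unset Strict Implicit.
Unset Printing Implicit Defensive.

(** * Algebra of tensor products of one-qubit matrices: products, scalars, traces, inverses *)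

Section TensorAlgebra.
Variable C : comNzRingType.

Lemma mxtrace_tensmx m n (A : 'M[C]_m) (B : 'M[C]_n) :
  \tr (A *t B) = \tr A * \tr B.
Proof. by rewrite /mxtrace mulr_sum; apply: eq_bigr => i _; rewrite mxE. Qed.

Lemma tens1mx1 m n : (1%:M : 'M[C]_m) *t (1%:M : 'M[C]_n) = 1%:M.
Proof.
apply/matrixP => i j; case: (mxtens_indexP i) => a b.
case: (mxtens_indexP j) => c d; rewrite tensmxE !mxE -natrM mulnb.
by rewrite (can_eq (@mxtens_indexK m n)) xpair_eqE.
Qed.

Lemma tensmxZZ m n p q a b (A : 'M[C]_(m, n)) (B : 'M[C]_(p, q)) :
  (a *: A) *t (b *: B) = (a * b) *: (A *t B).
Proof. by apply/matrixP => i j; rewrite !mxE mulrACA. Qed.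

Lemma eq_tensor n (A B : 'I_n -> 'M[C]_2) : A =1 B -> tensor A = tensor B.
Proof.
case: n A B => [//|n] /=; elim: n => [|n IHn] A B eqAB /=; first exact: eqAB.
by rewrite eqAB (IHn _ (fun i => B (lift ord0 i))).
Qed.

Lemma tensor1 n : tensor (fun _ : 'I_n => 1%:M) = 1%:M :> 'M[C]_(2 ^ n).
Proof.
by case: n => [//|n] /=; elim: n => [//|n IHn] /=; rewrite IHn tens1mx1.
Qed.

Lemma tensor_mul n (A B : 'I_n -> 'M[C]_2) :
  tensor A *m tensor B = tensor (fun i => A i *m B i).
Proof.
case: n A B => [|n] A B /=; first by rewrite mulmx1.
by elim: n A B => [//|n IHn] A B /=; rewrite -IHn -tensmx_mul.
Qed.

Lemma tensorZ n (c : 'I_n -> C) (A : 'I_n -> 'M[C]_2) :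
  tensor (fun i => c i *: A i) = (\prod_i c i) *: tensor A.
Proof.
case: n c A => [|n] c A /=; first by rewrite big_ord0 scale1r.
elim: n c A => [|n IHn] c A /=; first by rewrite big_ord1.
by rewrite IHn tensmxZZ [in RHS]big_ord_recl.
Qed.

Lemma mxtrace_tensor n (A : 'I_n -> 'M[C]_2) :
  \tr (tensor A) = \prod_i \tr (A i).
Proof.
case: n A => [|n] A /=; first by rewrite big_ord0 mxtrace1.
elim: n A => [|n IHn] A /=; first by rewrite big_ord1.
by rewrite mxtrace_tensmx IHn [in RHS]big_ord_recl.
Qed.

End TensorAlgebra.

Lemma tensor_mulmxV (F : fieldType) n (U : 'I_n -> 'M[F]_2) :
  (forall i, U i \in unitmx) ->
  tensor U *m tensor (fun i => invmx (U i)) = 1%:M.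
Proof.
by move=> uU; rewrite tensor_mul -tensor1; apply: eq_tensor => i; exact: mulmxV.
Qed.

Lemma tensor_unitmx (F : fieldType) n (U : 'I_n -> 'M[F]_2) :
  (forall i, U i \in unitmx) -> tensor U \in unitmx.
Proof. by move=> /tensor_mulmxV /mulmx1_unit[]. Qed.

Lemma invmx_tensor (F : fieldType) n (U : 'I_n -> 'M[F]_2) :
  (forall i, U i \in unitmx) ->
  invmx (tensor U) = tensor (fun i => invmx (U i)).
Proof.
move=> uU.
by rewrite -[RHS](mulKmx (tensor_unitmx uU)) tensor_mulmxV // mulmx1.
Qed.

(* Locked: unification otherwise unfolds the matrix products. *)
HB.lock Definition trc (F : fieldType) (U A B : 'M[F]_2) : F :=
  \tr (U *m A *m invmx U *m B).

(** * Sign-alternating functions on a connected graph *)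

Section AlternatingFunctions.
Variables (F : numDomainType) (T : finType) (e : rel T).
Hypothesis e_conn : connected_graph e.

(** Along a path from [x0] the value only changes sign, so by connectedness just [f x0] and [- f x0]
    occur. They differ because [f x0] is nonzero, and the level set of the first is one side of the
    bipartition. *)
Lemma alternating_bipartite (f : T -> F) x0 :
  (forall x y, e x y -> f x = - f y) -> f x0 != 0 -> bipartite e.
Proof.
move=> alt fx0; have fpm x : f x = f x0 \/ f x = - f x0.
  case/connectP: (e_conn x0 x) => p + ->.
  have: f x0 = f x0 \/ f x0 = - f x0 by left.
  (* The occurrence list generalises the start of the path while [f x0] stays fixed as the reference
     value. *)
  elim: p {1 3 5 6 8}x0 => [//|y p IHp] z fz /= /andP[zy]; apply: IHp => {p}.
  have := alt _ _ zy; case: fz => -> h; first by right; rewrite h opprK.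
  by left; apply: oppr_inj.
exists [set x | f x == f x0] => x y xy; rewrite !inE (alt _ _ xy).
have neq : - f x0 != f x0 by rewrite eqNr.
by case: (fpm y) => ->; rewrite ?opprK eqxx ?(negPf neq) // eq_sym.
Qed.

Lemma connected_neighbour (x y : T) : x != y -> exists z, e x z.
Proof.
move=> xy; case/connectP: (e_conn x y) xy => -[|z p] /=.
  by move=> _ ->; rewrite eqxx.
by case/andP=> xz _ _ _; exists z.
Qed.

(** If [f x0] vanishes, crossing an edge at [x0] back and forth gives [kappa ^ 2 * g x0 = g x0],
    hence [kappa = 1] and [g] itself alternates. The second vertex [x1] guarantees such an edge. *)
Lemma scaled_alternating_bipartite (kappa : F) (f g : T -> F) x0 x1 :
  symmetric e -> x0 != x1 -> kappa != -1 ->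
  (forall x y, e x y -> f x = - f y) ->
  (forall x y, e x y -> kappa * g x = - g y) ->
  (f x0 = 0 -> g x0 != 0) -> bipartite e.
Proof.
move=> e_sym x01 kN1 altf altg fg.
have [/fg gx0|fx0] := eqVneq (f x0) 0; last first.
  exact: alternating_bipartite altf fx0.
have [y x0y] := connected_neighbour x01.
have k1 : kappa = 1.
  have gE : kappa * kappa * g x0 = 1 * g x0.
    by rewrite -mulrA (altg _ _ x0y) mulrN (altg y x0) ?opprK ?mul1r // e_sym.
  have /eqP := mulIf gx0 gE.
  by rewrite -expr2 sqrf_eq1 (negPf kN1) orbF => /eqP.
apply: alternating_bipartite gx0 => x z /altg.
by rewrite k1 mul1r.
Qed.

End AlternatingFunctions.

(** * Pauli matrices and their trace pairing *)

Section Pauli.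
Variable R : realType.
Notation C := R[i].
Notation X := (sigma_x R).
Notation Y := (sigma_y R).

Definition sigma_z : 'M[C]_2 :=
  \matrix_(a, b) (if a == b then if a == ord0 then 1 else -1 else 0).
Notation Z := sigma_z.

Lemma mxtrace2 (A : 'M[C]_2) : \tr A = A ord0 ord0 + A ord_max ord_max.
Proof.
rewrite /mxtrace big_ord_recl big_ord1.
by congr (_ + A _ _); apply: val_inj.
Qed.

Lemma mulmx2E (A B : 'M[C]_2) i j :
  (A *m B) i j = A i ord0 * B ord0 j + A i ord_max * B ord_max j.
Proof.
rewrite mxE big_ord_recl big_ord1.
by congr (_ + A _ _ * B _ _); apply: val_inj.
Qed.

Lemma matrix2P (A B : 'M[C]_2) :
  A ord0 ord0 = B ord0 ord0 -> A ord0 ord_max = B ord0 ord_max ->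
  A ord_max ord0 = B ord_max ord0 -> A ord_max ord_max = B ord_max ord_max ->
  A = B.
Proof.
move=> *; apply/matrixP => i j.
have ord2 (k : 'I_2) : k = ord0 \/ k = ord_max.
  by case: k => [[|[|]]] // ?; [left|right]; apply: val_inj.
by case: (ord2 i) => ->; case: (ord2 j) => ->.
Qed.

Lemma mul_ii : ('i%C * 'i%C = -1 :> C).
Proof. by rewrite -expr2 sqr_i. Qed.

Lemma pauli_tr0 : [/\ \tr X = 0, \tr Y = 0 & \tr Z = 0].
Proof. by split; rewrite mxtrace2 !mxE /= ?addr0 ?subrr. Qed.

Lemma pauli_trM :
  [/\ \tr (X *m X) = 2, \tr (Y *m Y) = 2, \tr (X *m Y) = 0,
  \tr (X *m Z) = 0 & \tr (Y *m Z) = 0].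
Proof.
split; rewrite mxtrace2 !mulmx2E !mxE /=; ring: mul_ii.
Qed.

(** Together with the identity the Pauli matrices span all 2x2 matrices: twice each entry of [A] is
    a combination of the four traces. *)
Lemma pauli_complete (A : 'M[C]_2) :
  \tr A = 0 -> \tr (A *m X) = 0 -> \tr (A *m Y) = 0 -> \tr (A *m Z) = 0 ->
  A = 0.
Proof.
rewrite !mxtrace2 !mulmx2E !mxE /=.
set a := A ord0 ord0; set b := A ord0 ord_max; set c := A ord_max ord0.
set d := A ord_max ord_max.

rewrite !(mulr0, mulr1, addr0, add0r) => h1 hx hy hz.
have c2 : (2 : C) != 0 by rewrite pnatr_eq0.
have zero2 (u : C) : 2 * u = 0 -> u = 0.
  by move/eqP; rewrite mulf_eq0 (negPf c2) => /eqP.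
apply: matrix2P; rewrite [RHS]mxE -/a -/b -/c -/d; apply: zero2.
- have -> : 2 * a = (a + d) + (a + d * -1) by ring.
  by rewrite h1 hz addr0.
- have -> : 2 * b = (b + c) - 'i%C * (b * 'i%C + c * - 'i%C) by ring: mul_ii.
  by rewrite hx hy mulr0 subr0.
- have -> : 2 * c = (b + c) + 'i%C * (b * 'i%C + c * - 'i%C) by ring: mul_ii.
  by rewrite hx hy mulr0 addr0.
- have -> : 2 * d = (a + d) - (a + d * -1) by ring.
  by rewrite h1 hz subr0.
Qed.

(** * Necessity: trace identities forced by an inverting local unitary *)

(** The trace factorises over the qubits, and a qubit outside the pair [p], [q] of a coupling term
    contributes [\tr (S j)]. As [S k] and [S l] are traceless, only the term of the pair [k], [l]
    survives. *)
Lemma mxtrace_conj_HXY n (J : 'I_n -> 'I_n -> R) kappa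
    (U S : 'I_n -> 'M[C]_2) (k l : 'I_n) : (forall i, U i \in unitmx) ->
  (k < l)%N -> \tr (S k) = 0 -> \tr (S l) = 0 ->
  \tr (tensor U *m HXY J kappa *m invmx (tensor U) *m tensor S) =
  (pi : R)%:C%C * ((J k l)%:C%C / 2) *
    (\prod_(j | (j != k) && (j != l)) \tr (S j)) *
    (trc (U k) X (S k) * trc (U l) X (S l) +
     kappa%:C%C * (trc (U k) Y (S k) * trc (U l) Y (S l))).
Proof.
move=> uU kl Sk0 Sl0.
pose phi s p q :=
  \tr (tensor U *m two_qubit s p q *m invmx (tensor U) *m tensor S).
have phiE s p q : phi s p q =
    \prod_j (if (j == p) || (j == q) then trc (U j) s (S j) else \tr (S j)).
  rewrite /phi invmx_tensor // !tensor_mul mxtrace_tensor.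
  apply: eq_bigr => j _; rewrite trc.unlock; case: ifP => // _.
  by rewrite mulmx1 mulmxV // mul1mx.
have phi0 s p q : (k != p) && (k != q) || (l != p) && (l != q) -> phi s p q = 0.
  rewrite phiE; case/orP; rewrite -negb_or => /negPf h.
    by rewrite (bigD1 k) //= h Sk0 mul0r.
  by rewrite (bigD1 l) //= h Sl0 mul0r.
have klN : l != k by rewrite -val_eqE /= gtn_eqF.
have phi1 s : phi s k l = (\prod_(j | (j != k) && (j != l)) \tr (S j)) *
    (trc (U k) s (S k) * trc (U l) s (S l)).
  rewrite phiE (bigD1 k) //= eqxx (bigD1 l) //= eqxx orbT mulrA mulrC.
  by congr (_ * _); apply: eq_bigr => j /andP[/negPf-> /negPf->].
have -> : \tr (tensor U *m HXY J kappa *m invmx (tensor U) *m tensor S) =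
    (pi : R)%:C%C * \sum_(p < n) \sum_(q < n | (p < q)%N)
      ((J p q)%:C%C / 2) * (phi X p q + kappa%:C%C * phi Y p q).
  rewrite /HXY -scalemxAr -!scalemxAl mxtraceZ; congr (_ * _).
  rewrite mulmx_sumr !mulmx_suml raddf_sum; apply: eq_bigr => p _.
  rewrite mulmx_sumr !mulmx_suml raddf_sum; apply: eq_bigr => q _.
  rewrite /= -scalemxAr -!scalemxAl mxtraceZ; congr (_ * _).
  by rewrite mulmxDr !mulmxDl -scalemxAr -!scalemxAl mxtraceD mxtraceZ.
clearbody phi; move: {phiE}phi0 phi1 => phi0 phi1.
rewrite (bigD1 k) //= (bigD1 l) //=.
rewrite big1 => [|q /andP[kq ql]]; last first.
  rewrite !phi0 ?mulr0 ?addr0 ?mulr0 // [l == q]eq_sym ql klN orbT //.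
rewrite addr0 big1 => [|p pk].
  by rewrite addr0 !phi1 [kappa%:C%C * _]mulrCA -mulrDr !mulrA.
rewrite big1 // => q pq.
(* With [p] different from [k], the pair could only match as [p = l], [q = k], which contradicts
   [k < l] and [p < q]. *)
have h : (k != p) && (k != q) || (l != p) && (l != q).
  rewrite [k == p]eq_sym pk /=; case: (eqVneq k q) => //= kq; subst q.
  rewrite klN andbT; apply/eqP => lp; subst p.
  by move: (ltn_trans kl pq); rewrite ltnn.
by rewrite !phi0 ?mulr0 ?addr0 ?mulr0.
Qed.

(** Both sides of the inversion equation are evaluated by the preceding trace formula, the right one
    with the identity in place of [U], and the common nonzero prefactor is cancelled. *)
Lemma inverting_trc_lt n (J : 'I_n -> 'I_n -> R) kappa (U : 'I_n -> 'M[C]_2)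
    (A B : 'M[C]_2) (k l : 'I_n) : (forall i, U i \in unitmx) ->
  tensor U *m HXY J kappa *m invmx (tensor U) = - HXY J kappa ->
  (k < l)%N -> J k l != 0 -> \tr A = 0 -> \tr B = 0 ->
  trc (U k) X A * trc (U l) X B + kappa%:C%C * (trc (U k) Y A * trc (U l) Y B) =
  - (\tr (X *m A) * \tr (X *m B) + kappa%:C%C * (\tr (Y *m A) * \tr (Y *m B))).
Proof.
move=> uU anti kl Jkl A0 B0.
have klN : l != k by rewrite -val_eqE /= gtn_eqF.
pose S j := if j == k then A else if j == l then B else 1%:M.
have Sk : S k = A by rewrite /S eqxx.
have Sl : S l = B by rewrite /S (negPf klN) eqxx.
have Sk0 : \tr (S k) = 0 by rewrite Sk.
have Sl0 : \tr (S l) = 0 by rewrite Sl.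
have trc1 s M : trc 1%:M s M = \tr (s *m M).
  by rewrite trc.unlock invmx1 mulmx1 mul1mx.
have := mxtrace_conj_HXY J kappa (fun _ => unitmx1 _ _) kl Sk0 Sl0.
have := mxtrace_conj_HXY J kappa uU kl Sk0 Sl0.
rewrite anti tensor1 invmx1 mulmx1 mul1mx mulNmx raddfN /= !trc1 Sk Sl.
move=> e1 e2; move: e1; rewrite e2; set c := _ * (\prod_(j | _) _) => e.
(* Away from [k] and [l] the test matrix is the identity, of trace 2. *)
have c0 : c != 0.
  rewrite /c !mulf_neq0 //.
  - by rewrite (fmorph_eq0 (real_complex R)) gt_eqF // pi_gt0.
  - by rewrite (fmorph_eq0 (real_complex R)).
  - by rewrite invr_eq0 pnatr_eq0.
  - rewrite prodf_seq_neq0; apply/allP => j _; apply/implyP.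
    by move=> /andP[/negPf jk /negPf jl]; rewrite /S jk jl mxtrace1 pnatr_eq0.
by apply: (mulfI c0); rewrite mulrN -e.
Qed.

(** Testing qubit [l] against the conjugate of [B] by [U l] moves the unknown rotation of that qubit
    to the right-hand side, leaving the computable traces [\tr (X *m B)] and [\tr (Y *m B)] on the
    left. *)
Lemma inverting_trc n (J : 'I_n -> 'I_n -> R) kappa (U : 'I_n -> 'M[C]_2)
    (A B : 'M[C]_2) (k l : 'I_n) : (forall i, U i \in unitmx) ->
  tensor U *m HXY J kappa *m invmx (tensor U) = - HXY J kappa ->
  coupling J k l -> \tr A = 0 -> \tr B = 0 ->
  trc (U k) X A * \tr (X *m B) + kappa%:C%C * (trc (U k) Y A * \tr (Y *m B)) =
  - (\tr (X *m A) * trc (U l) B X +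
     kappa%:C%C * (\tr (Y *m A) * trc (U l) B Y)).
Proof.
move=> uU anti kl A0 B0; pose B' := U l *m B *m invmx (U l).
have B'0 : \tr B' = 0 by rewrite /B' mxtrace_mulC mulmxA mulVmx // mul1mx.
have trcB' s : trc (U l) s B' = \tr (s *m B).
  by rewrite trc.unlock /B' !mulmxA mulmxKV // mxtrace_mulC !mulmxA mulVmx //
    mul1mx.
have trB' s : \tr (s *m B') = trc (U l) B s by rewrite trc.unlock mxtrace_mulC.
rewrite -!trcB' -!trB'; case/orP: kl => /andP[kl Jkl].
  exact: inverting_trc_lt uU anti kl Jkl A0 B'0.
have := inverting_trc_lt uU anti kl Jkl B'0 A0.
by rewrite (mulrC (trc (U l) X B')) (mulrC (trc (U l) Y B'))
  (mulrC (\tr (X *m B'))) (mulrC (\tr (Y *m B'))).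
Qed.

(** The three numbers are the Pauli components of the traceless matrix [invmx U *m X *m U]; if all
    vanished, so would [X]. *)
Lemma trc_row_neq0 (U : 'M[C]_2) : U \in unitmx ->
  trc U X X = 0 -> trc U Z X = 0 -> trc U Y X != 0.
Proof.
move=> uU XX ZX; apply/eqP => YX.
have trcE A : trc U A X = \tr (invmx U *m X *m U *m A).
  by rewrite trc.unlock -mulmxA mxtrace_mulC !mulmxA.
have /(congr1 (fun M => U *m M *m invmx U)) : invmx U *m X *m U = 0.
  apply: pauli_complete; rewrite -?trcE //.
  by rewrite mxtrace_mulC mulmxA mulmxV // mul1mx; case: pauli_tr0.
rewrite !mulmxA mulmxV // mul1mx mulmxK // mulmx0 mul0mx => /matrixP.
by move=> /(_ ord0 ord_max) /eqP; rewrite !mxE /= oner_eq0.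
Qed.

Lemma invertible_bipartite n (J : 'I_n -> 'I_n -> R) kappa : (2 <= n)%N ->
  connected_graph (coupling J) -> typeI_invertible (HXY J kappa) ->
  kappa != -1 -> bipartite (coupling J).
Proof.
move=> n2 conn [K [[U [SU ->]] anti]] kN1.
have uU i : U i \in unitmx by case: (SU i) => /unitarymx_unit.
have [X0 Y0 Z0] := pauli_tr0; have [XX YY XY XZ YZ] := pauli_trM.
have YX : \tr (Y *m X) = 0 by rewrite mxtrace_mulC.
have c2 : (2 : C) != 0 by rewrite pnatr_eq0.
(* With [A = X] and [B] equal to [X], [Y], [Z] in turn, trace orthogonality leaves at most one term
   on each side. *)
have relX k l : coupling J k l -> trc (U k) X X = - trc (U l) X X.
  move=> /(inverting_trc uU anti)/(_ X0 X0).
  by rewrite XX YX !(mulr0, mul0r, addr0) mulrC -mulrN => /(mulfI c2).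
have relY k l : coupling J k l -> kappa%:C%C * trc (U k) Y X = - trc (U l) Y X.
  move=> /(inverting_trc uU anti)/(_ X0 Y0).
  rewrite XX XY YX YY !(mulr0, mul0r, addr0, add0r) mulrA mulrC -mulrN.
  by move=> /(mulfI c2).
have relZ k l : coupling J k l -> trc (U l) Z X = 0.
  move=> /(inverting_trc uU anti)/(_ X0 Z0).
  rewrite XX XZ YX YZ !(mulr0, mul0r, addr0, add0r) => /esym/eqP.
  by rewrite oppr_eq0 mulf_eq0 (negPf c2) => /eqP.
have symJ : symmetric (coupling J) by move=> k l; rewrite /coupling orbC.
pose i0 : 'I_n := Ordinal (ltnW n2); pose i1 : 'I_n := Ordinal n2.
have kN1' : kappa%:C%C != -1 :> C.
  by rewrite -(rmorphN1 (real_complex R)) (inj_eq (@complexI R)).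
(* [relZ] speaks only of endpoints of edges, so [i0] needs a neighbour. *)
have [l i0l] := connected_neighbour conn (isT : i0 != i1).
apply: (scaled_alternating_bipartite conn symJ (isT : i0 != i1) kN1' relX relY).
by move=> XX0; apply: trc_row_neq0; rewrite ?(relZ l) // symJ.
Qed.

(** * Sufficiency: inverting local unitaries from rotations about the z axis *)

Lemma invertible_of_anticomm n (J : 'I_n -> 'I_n -> R) kappa
    (U : 'I_n -> 'M[C]_2) : (forall l, in_SU2 (U l)) ->
  (forall k l : 'I_n, (k < l)%N -> J k l != 0 ->
     tensor U *m (two_qubit X k l + kappa%:C%C *: two_qubit Y k l) =
     - ((two_qubit X k l + kappa%:C%C *: two_qubit Y k l) *m tensor U)) ->
  typeI_invertible (HXY J kappa).
Proof.
move=> SU anti; exists (tensor U); split; first by exists U.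
have uT : tensor U \in unitmx.
  by apply: tensor_unitmx => l; case: (SU l) => /unitarymx_unit.
suff -> : tensor U *m HXY J kappa = - HXY J kappa *m tensor U by rewrite mulmxK.
rewrite /HXY mulNmx -scalemxAr -scalemxAl -scalerN; congr (_ *: _).
rewrite mulmx_sumr mulmx_suml -sumrN; apply: eq_bigr => k _.
rewrite mulmx_sumr mulmx_suml -sumrN; apply: eq_bigr => l kl.
rewrite -scalemxAr -scalemxAl -scalerN.
have [->|Jkl] := eqVneq (J k l) 0; first by rewrite mul0r !scale0r.
by rewrite anti.
Qed.


(** Qubits other than [k] and [l] carry the identity in the pair term, so they contribute no
    scalar. *)
Lemma tensor_two_qubit n (U : 'I_n -> 'M[C]_2) (c : 'I_n -> C)
    s t (k l : 'I_n) :
  (k < l)%N -> (forall j, U j *m s = c j *: (t *m U j)) ->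
  tensor U *m two_qubit s k l = (c k * c l) *: (two_qubit t k l *m tensor U).
Proof.
move=> kl Us; have klN : l != k by rewrite -val_eqE /= gtn_eqF.
have -> : c k * c l = \prod_j (if (j == k) || (j == l) then c j else 1).
  rewrite (bigD1 k) //= eqxx (bigD1 l) //= eqxx orbT big1 ?mulr1 //.
  by move=> j /andP[/negPf-> /negPf->].
rewrite /two_qubit !tensor_mul -tensorZ; apply: eq_tensor => j.
by case: ifP => _; rewrite ?Us // mulmx1 mul1mx scale1r.
Qed.

(** For [w] of modulus 1 this is a rotation about the z axis, normalised to determinant 1. *)
Definition phase (w : C) : 'M[C]_2 :=
  \matrix_(a, b) (if a == b then if a == ord0 then w^* else w else 0).

Lemma phase_SU2 (w : C) : w * w^* = 1 -> in_SU2 (phase w).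
Proof.
move=> w1; split.
  apply/unitarymxP/matrix2P; rewrite mulmx2E !mxE /= ?conjC0 ?conjCK;
   by rewrite ?(mulr0, mul0r, addr0, add0r) // mulrC.
rewrite det_trig; last first.
  by apply/is_trig_mxP => i j ij; rewrite mxE -val_eqE /= ltn_eqF.
by rewrite big_ord_recl big_ord1 !mxE /= mulrC.
Qed.

Lemma phase_mulmx (w c : C) (s t : 'M[C]_2) :
  s ord0 ord0 = 0 -> s ord_max ord_max = 0 ->
  t ord0 ord0 = 0 -> t ord_max ord_max = 0 ->
  w^* * s ord0 ord_max = c * (t ord0 ord_max * w) ->
  w * s ord_max ord0 = c * (t ord_max ord0 * w^*) ->
  phase w *m s = c *: (t *m phase w).
Proof.
move=> s00 s11 t00 t11 e01 e10.
apply: matrix2P; rewrite mulmx2E [RHS]mxE mulmx2E !mxE /= ?s00 ?s11 ?t00 ?t11;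
  by rewrite !(mul0r, mulr0, addr0, add0r).
Qed.

Lemma bipartite_invertible n (J : 'I_n -> 'I_n -> R) kappa :
  bipartite (coupling J) -> typeI_invertible (HXY J kappa).
Proof.
move=> [A bip].
(* On [A] the phase matrix is ['i *: sigma_z], the multiple of [sigma_z] needed for determinant 1;
   elsewhere it is the identity. The sign [c j] records whether it anticommutes or commutes with [X]
   and [Y]. *)
pose w (j : 'I_n) : C := if j \in A then - 'i%C else 1.
pose c (j : 'I_n) : C := if j \in A then -1 else 1.
have wJ j : (w j)^* = c j * w j.
  rewrite /w /c; case: ifP => _; last by rewrite conjC1 mulr1.
  by apply/eqP; rewrite eq_complex /=; apply/andP; split; apply/eqP; ring.
have cc j : c j * c j = 1 by rewrite /c; case: ifP; rewrite ?mulrNN mulr1.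
apply: (@invertible_of_anticomm _ _ _ (fun j => phase (w j))) => [l|k l kl Jkl].
  apply: phase_SU2; rewrite wJ /w /c; case: ifP => _; last by rewrite !mulr1.
  by ring: mul_ii.
(* Exactly one end of an edge lies in [A]. *)
have ckl : c k * c l = -1.
  have := bip k l; rewrite /coupling kl Jkl /c => /(_ isT).
  by case: ifP; case: ifP => //; rewrite ?mulr1 ?mul1r.
have comm (s : 'M[C]_2) j : s ord0 ord0 = 0 -> s ord_max ord_max = 0 ->
    phase (w j) *m s = c j *: (s *m phase (w j)).
  move=> s00 s11; apply: phase_mulmx => //; rewrite wJ.
    by rewrite -mulrA [w j * _]mulrC.
  by rewrite mulrCA (mulrA (c j)) cc mul1r mulrC.
have sX j : phase (w j) *m X = c j *: (X *m phase (w j)).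
  by apply: comm; rewrite mxE.
have sY j : phase (w j) *m Y = c j *: (Y *m phase (w j)).
  by apply: comm; rewrite mxE.
rewrite mulmxDr -scalemxAr (tensor_two_qubit kl sX) (tensor_two_qubit kl sY).
by rewrite ckl !scaleN1r scalerN -opprD scalemxAl -mulmxDl.
Qed.

Lemma antisymmetric_invertible n (J : 'I_n -> 'I_n -> R) :
  typeI_invertible (HXY J (-1)).
Proof.
pose a : R := (Num.sqrt 2)^-1; have a2 : a * a = 2^-1.
  by rewrite -invfM -expr2 sqr_sqrtr // ler0n.
(* This is the primitive eighth root of unity with argument [pi / 4]; its phase matrix is the
   quarter turn sending [X] to [Y] and [Y] to [- X]. *)
pose w : C := (a +i* a)%C.
have wJ : w^* = - 'i%C * w.
  by apply/eqP; rewrite eq_complex /=; apply/andP; split; apply/eqP; ring.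
have w1 : w * w^* = 1.
  apply/eqP; rewrite eq_complex /= !mulrN opprK a2 addNr eqxx andbT.
  by apply/eqP; field.
have sX j : (fun _ : 'I_n => phase w) j *m X = 1 *: (Y *m phase w).
  by apply: phase_mulmx; rewrite !mxE //= wJ; ring: mul_ii.
have sY j : (fun _ : 'I_n => phase w) j *m Y = -1 *: (X *m phase w).
  by apply: phase_mulmx; rewrite !mxE //= wJ; ring: mul_ii.
apply: (@invertible_of_anticomm _ _ _ (fun _ => phase w)) => [l|k l kl Jkl].
  exact: phase_SU2.
(* The minus sign from [Y] occurs on both qubits and cancels, so the XX and YY terms are exchanged
   and their difference changes sign. *)
rewrite mulmxDr -scalemxAr.
rewrite (@tensor_two_qubit _ _ (fun _ => 1) _ _ _ _ kl sX).
rewrite (@tensor_two_qubit _ _ (fun _ => -1) _ _ _ _ kl sY).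
rewrite mulr1 mulrNN mulr1 !scale1r rmorphN rmorph1 !scaleN1r.
by rewrite mulmxBl opprB addrC.
Qed.

End Pauli.

Theorem lemma6 (R : realType) (n : nat) (hn : (2 <= n)%N)
    (J : 'I_n -> 'I_n -> R) (kappa : R) (hkappa : -1 <= kappa <= 1)
    (hconn : connected_graph (coupling J)) :
  typeI_invertible (HXY J kappa) <-> (bipartite (coupling J) \/ kappa = -1).
Proof.
split=> [inv|[bip|->]]; last exact: antisymmetric_invertible.
  have [->|kN1] := eqVneq kappa (-1); first by right.
  by left; exact: invertible_bipartite inv kN1.
exact: bipartite_invertible.
Qed.
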